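(* Let $f(x) \coloneqq 1 + \min_{k \in \mathbb{N}} \frac{2x + 2^{k-3}}{k}$, where $\mathbb{N}$ denotes the positive integers. If $G$ is a finite graph of girth at least $7$, then $G$ admits a fractional colouring $c$ such that for every induced subgraph $H$ of $G$, the restriction of $c$ to $H$ has weight at most $f\left(\max\{\deg_G(v) : v\in V(H)\}\right)$. In particular, $\chi_f(G) \le f(\Delta(G))$.
   Context: The girth of a graph is the length of a shortest cycle ($+\infty$ for forests). A fractional colouring of $G$ is an assignment of non-negative weights $c(I)$ to independent sets $I$ of $G$ such that every vertex $v$ satisfies $\sum_{I\ni v} c(I)\ge 1$; its weight is $\sum_I c(I)$. The restriction of $c$ to an induced subgraph $H$ is the fractional colouring of $H$ giving to each independent set $J$ of $H$ the weight $\sum_{I:\, I\cap V(H)=J} c(I)$; its weight is the total weight of the non-empty independent sets of $H$ thus obtained. $\chi_f(G)$ is the minimum weight of a fractional colouring of $G$, and $\Delta(G)$ is the maximum degree; $\deg_G(v)$ is the degree of $v$ in $G$. *)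

(* Defs.v *)
From HB Require Import structures.
From mathcomp Require Import all_boot all_order all_algebra.
From mathcomp Require Import all_classical all_reals all_analysis.
From mathcomp Require Import zify.

Set Implicit Arguments.
Unset Strict Implicit.
Unset Printing Implicit Defensive.

Import Order.TTheory GRing.Theory Num.Theory.
Import numFieldNormedType.Exports.

Local Open Scope classical_set_scope.
Local Open Scope ring_scope.

Record sgraph : Type := SGraph {
  vertex :> finType;
  edge : rel vertex;
  edge_sym : symmetric edge;
  edge_irr : irreflexive edge
}.

Definition deg (G : sgraph) (v : G) : nat := #|edge v|.

Definition max_deg (G : sgraph) : nat := (\max_(v : G) deg v)%N.

(* A cycle is given by the cyclic sequence of its vertices; the condition on
   the size discards the closed walks [:: x; y] along a single edge. *)
Definition is_cycle (G : sgraph) (s : seq G) : bool :=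
  ucycleb (@edge G) s && (2 < size s)%N.

(* The infimum of the empty set in \bar R is +oo, the girth of a forest. *)
Definition girth (R : realType) (G : sgraph) : \bar R :=
  ereal_inf [set ((size s)%:R)%:E | s in [set s : seq G | is_cycle s]].

Definition independent (G : sgraph) (I : {set G}) : bool :=
  [forall x in I, forall y in I, ~~ edge x y].

Section Induced.
Variables (G : sgraph) (S : {set G}).

Definition induced_edge : rel {x : G | x \in S} :=
  fun x y => edge (val x) (val y).

Fact induced_edge_sym : symmetric induced_edge.
Proof. by move=> x y; exact: edge_sym. Qed.

Fact induced_edge_irr : irreflexive induced_edge.
Proof. by move=> x; exact: edge_irr. Qed.

Definition induced : sgraph := SGraph induced_edge_sym induced_edge_irr.

End Induced.

(* Weights on independent sets are represented by functions on all vertex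
   subsets that vanish outside the independent ones. *)
Definition fractional_colouring (R : realType) (G : sgraph)
    (c : {set G} -> R) : Prop :=
  [/\ forall I : {set G}, 0 <= c I,
      forall I : {set G}, ~~ independent I -> c I = 0 &
      forall v : G, 1 <= \sum_(I : {set G} | v \in I) c I].

Definition weight (R : realType) (G : sgraph) (c : {set G} -> R) : R :=
  \sum_(I : {set G}) c I.

Definition restriction (R : realType) (G : sgraph) (c : {set G} -> R)
    (S : {set G}) : {set induced S} -> R :=
  fun J => \sum_(I : {set G} | (I :&: S == val @: J)%SET) c I.

Definition restriction_weight (R : realType) (G : sgraph) (c : {set G} -> R)
    (S : {set G}) : R :=
  \sum_(J : {set induced S} | independent J && (J != finset.set0))
    restriction c J.

(* The infima in the next two definitions are minima:
   see chi_f_attained and f_bound_attained. *)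
Definition chi_f (R : realType) (G : sgraph) : R :=
  inf [set weight c | c in [set c : {set G} -> R | fractional_colouring c]].

Definition f_bound (R : realType) (x : R) : R :=
  1 + inf [set (2 * x + 2 ^ (k%:Z - 3)) / k%:R
          | k in [set k : nat | (0 < k)%N]].

Lemma restriction_colouring (R : realType) (G : sgraph) (c : {set G} -> R)
    (S : {set G}) :
  fractional_colouring c -> fractional_colouring (@restriction R G c S).
Proof.
move=> [c0 cI c1]; split=> [J|J nJ|v].
- exact: sumr_ge0.
- apply: big1 => I /eqP IJ; apply: cI; apply: contra nJ => /forall_inP iI.
  have sub x : x \in J -> val x \in I.
    by move=> xJ; have := imset_f val xJ; rewrite -IJ inE => /andP[].
  apply/forall_inP => x /sub xI; apply/forall_inP => y /sub yI.
  by move/forall_inP: (iI _ xI); apply.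
- apply: le_trans (c1 (val v)) _.
  rewrite (partition_big (fun I : {set G} => [set x : induced S | val x \in I]%SET)
    (fun J : {set induced S} => v \in J)) => [|I vI]; last by rewrite inE.
  apply: ler_sum => J vJ; rewrite /restriction.
  rewrite [leRHS]big_mkcond [leLHS]big_mkcond; apply: ler_sum => I _.
  case: ifP => [/andP[_ /eqP <-]|_]; last by case: ifP.
  rewrite ifT //; apply/eqP/setP => x; rewrite inE; apply/andP/imsetP.
    by move=> [xI xS]; exists (exist _ x xS) => //; rewrite inE.
  by move=> [y + ->]; rewrite inE => yI; split=> //; exact: (valP y).
Qed.

Lemma chi_f_attained (R : realType) (G : sgraph) :
  exists2 c : {set G} -> R, fractional_colouring c & weight c = chi_f R G.
Proof.
pose c0 (I : {set G}) : R := (#|I| == 1%N)%:R.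
have c0P : fractional_colouring c0.
  split=> [I|I|v]; first by rewrite /c0 ler0n.
    rewrite /c0; case: eqP => // /eqP/cards1P[x ->].
    suff -> : independent [set x]%SET by [].
    apply/forall_inP => y /set1P ->; apply/forall_inP => z /set1P ->.
    by rewrite edge_irr.
  rewrite (bigD1 [set v]%SET) /= ?set11// /c0 cards1 eqxx lerDl.
  by apply: sumr_ge0 => I _; rewrite ler0n.
pose T : topologicalType := prod_topology (fun _ : {set G} => R).
have sumC (P : pred {set G}) : continuous (fun c : T => \sum_(I | P I) c I).
  apply: continuous_big => [|I _]; first exact: add_continuous.
  exact: (@proj_continuous {set G} (fun _ => R) I).
pose A : set T := [set c | forall I : {set G}, c I \in `[0, weight c0]].
pose B : set T := [set c | fractional_colouring c].
have cA : compact A.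
  apply: (@tychonoff {set G} (fun _ => R) (fun _ => [set` `[0, weight c0]])) => I.
  exact: segment_compact.
have cB : closed B.
  have -> : B = (\bigcap_(I in [set: {set G}]) [set c : T | 0 <= c I]) `&`
      ((\bigcap_(I in [set I : {set G} | ~~ independent I])
          [set c : T | c I = 0]) `&`
       (\bigcap_(v in [set: G])
          [set c : T | 1 <= \sum_(I : {set G} | v \in I) c I])).
    apply/seteqP; split => c /=.
      by move=> [h1 h2 h3]; split=> [I _|]; [exact: h1|split=> [I /h2|v _]; [|exact: h3]].
    by move=> [h1 [h2 h3]]; split=> [I|I nI|v]; [exact: h1|exact: h2|exact: h3].
  have pC I : continuous (fun c : T => c I : R).
    exact: (@proj_continuous {set G} (fun _ => R) I).
  apply: closedI; [|apply: closedI]; apply: closed_bigI => i _.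
  - apply: (@closed_comp T R (fun c => c i) [set x | 0 <= x]).
      by move=> c _; exact: pC.
    exact: closed_ge.
  - apply: (@closed_comp T R (fun c => c i) [set x | x = 0]).
      by move=> c _; exact: pC.
    exact: closed_eq.
  - apply: (@closed_comp T R (fun c => \sum_(I : {set G} | i \in I) c I)
      [set x | 1 <= x]).
      by move=> c _; exact: sumC.
    exact: closed_ge.
have le_weight (c : {set G} -> R) I : fractional_colouring c -> c I <= weight c.
  by move=> [h _ _]; rewrite /weight (bigD1 I)//= lerDl; apply: sumr_ge0.
have ABn0 : (A `&` B) !=set0.
  exists c0; split=> //= I; rewrite in_itv/= le_weight// andbT.
  by case: c0P => /(_ I).
have [|c] := @compact_EVT_min T R (@weight R G) _ ABn0 (compact_closedI cA cB).
  by apply: continuous_subspaceT; exact: sumC.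
rewrite inE => -[_ Bc] cmin; exists c => //.
have cle (d : {set G} -> R) : fractional_colouring d -> weight c <= weight d.
  move=> dP; have [dc0|/ltW c0d] := leP (weight d) (weight c0).
    apply: (cmin d); rewrite inE; split=> //= I; rewrite in_itv/=.
    by rewrite (le_trans (le_weight d I dP) dc0) andbT; case: dP.
  apply: le_trans c0d; apply: (cmin c0); rewrite inE; split=> //= I.
  by rewrite in_itv/= le_weight// andbT; case: c0P => /(_ I).
apply/eqP; rewrite eq_le; apply/andP; split.
  by apply: lb_le_inf => [|_ [d dP <-]]; [exists (weight c), c|exact: cle].
apply: ge_inf; last by exists c.
by exists (weight c) => _ [d dP <-]; exact: cle.
Qed.

Lemma f_bound_attained (R : realType) (x : R) : 0 <= x ->
  exists2 k : nat, (0 < k)%N &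
    f_bound x = 1 + (2 * x + 2 ^ (k%:Z - 3)) / k%:R.
Proof.
move=> x0; pose g (k : nat) : R := (2 * x + 2 ^ (k%:Z - 3)) / k%:R.
suff [k k0 kmin] : exists2 k : nat, (0 < k)%N &
    forall j, (0 < j)%N -> g k <= g j.
  exists k => //; congr (_ + _); apply/eqP; rewrite eq_le; apply/andP; split.
    by apply: ge_inf; [exists (g k) => _ [j j0 <-]; exact: kmin|exists k].
  by apply: lb_le_inf => [|_ [j j0 <-]]; [exists (g k), k|exact: kmin].
have g_ge k : (3 < k)%N -> k%:R / 8 <= g k.
  move=> k3; have k0 : (0 : R) < k%:R by rewrite ltr0n; case: k k3.
  rewrite /g ler_pdivlMr//.
  have -> : (2 : R) ^ (k%:Z - 3) = 2 ^+ k / 8.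
    by rewrite expfzDr ?pnatr_eq0// -exprnP -exprnN; congr (_ / _); rewrite -natrX.
  apply: ler_wpDl; first by rewrite mulr_ge0.
  rewrite mulrAC ler_wpM2r// -natrM -natrX ler_nat.
  elim: k k3 {k0} => // k IH; rewrite leq_eqVlt => /predU1P[[<-]//|k3].
  have k4 : (4 * k <= k * k)%N by rewrite leq_mul2r (k3 : (4 <= k)%N) orbT.
  have := IH k3; have -> : (k.+1 * k.+1 = k * k + 2 * k + 1)%N by lia.
  by rewrite expnS; move: (2 ^ k)%N (k * k)%N k4 k3; lia.
pose N := maxn 4 (Num.bound (8 * g 1%N)).
have N0 : (1 < N.+1)%N by rewrite /N; lia.
pose i0 : 'I_N.+1 := Ordinal N0.
case: (@arg_minP _ _ _ i0 (fun i : 'I_N.+1 => (0 < i)%N) (fun i => g i) isT)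
  => i i1 imin; exists (nat_of_ord i) => // j j0.
have [jN|Nj] := ltnP j N.+1; first exact: (imin (Ordinal jN)).
apply: le_trans (imin i0 isT) _; apply: le_trans (g_ge j _); last first.
  by move: Nj; rewrite /N; lia.
rewrite ler_pdivlMr// mulrC (le_trans (ltW (archi_boundP _)))//.
  by rewrite mulr_ge0// /g divr1 addr_ge0 ?mulr_ge0// exprz_ge0.
rewrite ler_nat (leq_trans _ (ltnW Nj))//.
exact: leq_maxr.
Qed.

(* Main.v *)
(* For a vertex set S, draw a maximal independent set I of G[S] with
   probability proportional to 4^|I|. For every v in S and every k > 0,
     (1 + 2^(k-3)/k) P(v in I) + (2/k) E|I :&: N(v)| >= 1.
   To see this, condition on the trace J of I outside the ball of radius 2
   around v. As G has girth at least 7, I is then determined by A = I :&: N(v):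
   v is in I iff A is empty, and a vertex at distance 2 is in I iff it has no
   neighbour in J or A. The possible A are the subsets of N(v) that avoid some
   forbidden set and are either empty or contain Z, the set of neighbours of v
   all of whose children are dominated by J. The weight is a product over A,
   which makes the conditional inequality a statement about multi-affine sums.

   A fractional colouring is built greedily: always follow the distribution
   attached to the set S of vertices not yet fully coloured. By the inequality
   with k optimal for deg v, the vertex v stays uncoloured for a time of at most
   (1 + 2^(k-3)/k) + (2/k) deg v = f(deg v), and a set of vertices is met only
   as long as one of its vertices is uncoloured. *)

Require Import Defs.
From HB Require Import structures.
From mathcomp Require Import all_boot all_order all_algebra.
From mathcomp Require Import all_classical all_reals all_analysis.
From mathcomp Require Import zify ring lra.
From mathcomp Require Import fintype finset.
Set Implicit Arguments.
Unset Strict Implicit.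
Unset Printing Implicit Defensive.
Import Order.TTheory GRing.Theory Num.Theory.
Local Open Scope ring_scope.

(** * Maximal independent sets *)

Lemma independentP (G : sgraph) (I : {set G}) :
  reflect {in I &, forall x y, ~~ edge x y} (independent I).
Proof.
apply: (iffP idP) => [/forall_inP iI x y xI|iI].
  by move/forall_inP: (iI x xI); apply.
by apply/forall_inP => x xI; apply/forall_inP => y; exact: iI.
Qed.

(** Maximality is encoded as domination: an independent subset of [S] is inclusion-maximal iff every
    other vertex of [S] has a neighbour in it. *)
Definition maximal_independent (G : sgraph) (S I : {set G}) : bool :=
  [&& I \subset S, independent I &
      [forall x in S :\: I, exists y in I, edge x y]].

Lemma maximal_independentP (G : sgraph) (S I : {set G}) :
  reflect [/\ {subset I <= S}, {in I &, forall x y, ~~ edge x y} &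
              forall x, x \in S -> x \notin I -> exists2 y, y \in I & edge x y]
          (maximal_independent S I).
Proof.
apply: (iffP and3P) => [[/subsetP IS /independentP iI /forall_inP dI]|[IS iI dI]].
  by split=> // x xS xI; apply/exists_inP/dI; rewrite inE xI.
split; [exact/subsetP|exact/independentP|].
by apply/forall_inP => x; rewrite inE => /andP[xI xS]; apply/exists_inP; exact: dI.
Qed.

Lemma maximal_independent_exists (G : sgraph) (S : {set G}) :
  exists I, maximal_independent S I.
Proof.
have P0 : (set0 \subset S) && @independent G set0.
  by rewrite sub0set; apply/independentP => x y; rewrite inE.
case: (@arg_maxnP _ set0 (fun I : {set G} => (I \subset S) && independent I)
  (fun I => #|I|) P0) => I /andP[IS /independentP iI] Imax.
exists I; apply/maximal_independentP; split=> //; first exact/subsetP.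
move=> x xS xI; apply/exists_inP; apply: contraT => /exists_inPn nI.
have : (#|x |: I| <= #|I|)%N.
  apply: Imax; rewrite subUset sub1set xS IS /=; apply/independentP => y z.
  rewrite !inE => /predU1P[->|yI] /predU1P[->|zI]; rewrite ?edge_irr ?nI //.
    by rewrite edge_sym nI.
  exact: iI.
by rewrite cardsU1 xI ltnn.
Qed.

Lemma girth_cycle (R : realType) (G : sgraph) (g : nat) (s : seq G) :
  (g%:R%:E <= girth R G)%E -> is_cycle s -> (g <= size s)%N.
Proof.
move=> gG cs; have : (girth R G <= (size s)%:R%:E)%E by apply: ereal_inf_lbound; exists s.
by move=> /(le_trans gG); rewrite lee_fin ler_nat.
Qed.

(** * Multi-affine sums over subsets *)

Lemma big_subsetU1 (R : nmodType) (T : finType) (u : T) (B : {set T})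
    (F : {set T} -> R) : u \notin B ->
  \sum_(A : {set T} | A \subset (u |: B)%SET) F A =
  \sum_(A : {set T} | A \subset B) F A +
  \sum_(A : {set T} | A \subset B) F (u |: A)%SET.
Proof.
move=> uB; rewrite (bigID (fun A : {set T} => u \notin A)) /=; congr (_ + _).
  by apply: eq_bigl => A; rewrite -subsetD1 setU1K.
rewrite (reindex_onto (fun A : {set T} => u |: A)%SET (fun A => A :\ u)%SET) /=.
  apply: eq_bigl => A; rewrite setU11 andbT.
  have [AB|nAB] := boolP (A \subset B).
    have uA : u \notin A by apply: contra uB; exact: (subsetP AB).
    by rewrite setUS // setU1K // eqxx.
  apply: contraNF nAB => /andP[sAB /eqP eA].
  by rewrite -(setU1K uB) -eA setSD.
by move=> A /andP[_]; rewrite negbK => uA; rewrite setD1K.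
Qed.

(** The case [B = set0] of [sum_subsets_le]. Integrality matters: the inequality fails for real y
    strictly between 1 and 2. *)
Lemma int_le_expr2 (R : realFieldType) (y : int) : y%:~R <= 2 ^ (y - 1) :> R.
Proof.
have [y0|y0] := leP y 0.
  by rewrite (@le_trans _ _ 0) ?exprz_ge0// lerz0.
case: y y0 => [[|n]|] // _.
have -> : (n.+1%:Z - 1 = n) by lia.
rewrite -exprnP -natrX pmulrn ler_nat.
exact: ltn_expl.
Qed.

(* Induction on [B]: the sum is affine in each [r u], and at [r u = 1] the two
   halves combine to twice the sum for [y - 1]. *)
Lemma sum_subsets_le (R : realFieldType) (T : finType) (r : T -> R)
    (B : {set T}) (y : int) : (forall u, u \in B -> 0 <= r u <= 1) ->
  \sum_(A : {set T} | A \subset B)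
    (\prod_(u in A) r u) * (y%:~R - 2 * #|A|%:R) <= 2 ^ (y - 1).
Proof.
have [n] := ubnP #|B|; elim: n => // n IH in B y * => Bn r01.
have [->|[u uB]] := set_0Vmem B.
  rewrite (big_pred1 set0) => [|A]; last by rewrite subset0.
  by rewrite big_set0 cards0 mulr0 subr0 mul1r int_le_expr2.
have uC : u \notin (B :\ u)%SET by rewrite !inE eqxx.
have Cn : (#|(B :\ u)%SET| < n)%N by rewrite (cardsD1 u) uB in Bn.
have C01 x : x \in (B :\ u)%SET -> 0 <= r x <= 1 by rewrite inE => /andP[_ /r01].
have IHy z := IH _ z Cn C01.
rewrite -(setD1K uB) big_subsetU1 //.
set S := \sum_(A | _) _; set S' := \sum_(A | _) _.
have IH1 := IHy y; have IH2 := IHy (y - 1).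
(* Adding [u] to [A] lowers the last factor by 2, and y - 2 - 2|A| = 2 (y - 1 - 2|A|) - (y -
   2|A|). *)
have -> : S' = r u * (2 * \sum_(A : {set T} | A \subset (B :\ u)%SET)
    (\prod_(u in A) r u) * ((y - 1)%:~R - 2 * #|A|%:R) - S).
  rewrite mulrBr mulrA !mulr_sumr -sumrB; apply: eq_bigr => A AB.
  have uA : u \notin A by apply: contra uC; exact: (subsetP AB).
  rewrite big_setU1 // cardsU1 uA natrD intrB /=; ring.
have e : 2 ^ (y - 1) = 2 * 2 ^ (y - 1 - 1) :> R.
  by rewrite (expfzDr (y - 1) (-1)) // mulrCA divff ?mulr1.
move: IH1 IH2 (r01 u uB); rewrite -/S; set X := \sum_(A | _) _ => IH1 IH2 /andP[r0 r1].
(* The whole sum is the convex combination of [S] and [2 * X] with weights [1 - r u] and [r u]. *)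
have : r u * (2 * X) <= r u * 2 ^ (y - 1) by rewrite ler_wpM2l // e; lra.
have : (1 - r u) * S <= (1 - r u) * 2 ^ (y - 1) by rewrite ler_wpM2l // subr_ge0.
lra.
Qed.

(* Here [r u] stands for [4 ^ (1 - n)], where [n] is the number of children
   that join the independent set when [u] leaves it, so [Z] is the set of
   childless [u]; the factor 4 at [A = set0] is the contribution of [v]. Each
   element of [Z] contributes [r u = 4] and shifts [y] by 2 in
   [sum_subsets_le], and these two effects cancel. *)
Lemma config_sum_le (R : realFieldType) (T : finType) (r : T -> R)
    (U Z : {set T}) (k : nat) : (0 < k)%N -> Z \subset U ->
  (forall u, u \in Z -> r u = 4) ->
  (forall u, u \in (U :\: Z)%SET -> 0 <= r u <= 1) ->
  \sum_(A : {set T} | (A \subset U) && ((A == set0) || (Z \subset A)))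
    (\prod_(u in A) r u) * (if A == set0 then 4 else 1) *
    (1 - (1 + 2 ^ (k%:Z - 3) / k%:R) * (A == set0)%:R
       - 2 / k%:R * #|A|%:R) <= 0.
Proof.
move=> k0 ZU rZ rB.
have kR : (k%:R : R) != 0 by rewrite pnatr_eq0 -lt0n.
rewrite (bigD1 set0) /= ?sub0set ?eqxx // big_set0 cards0.
(* Adding [A = set0] to the sum if [Z] is empty adds 1. *)
have le1 : \sum_(A : {set T} | (A \subset U) &&
      ((A == set0) || (Z \subset A)) && (A != set0))
    (\prod_(u in A) r u) * (if A == set0 then 4 else 1) *
    (1 - (1 + 2 ^ (k%:Z - 3) / k%:R) * (A == set0)%:R
       - 2 / k%:R * #|A|%:R) <=
  \sum_(A : {set T} | (A \subset U) && (Z \subset A))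
    (\prod_(u in A) r u) * (1 - 2 / k%:R * #|A|%:R).
  rewrite big_mkcond [leRHS]big_mkcond; apply: ler_sum => A _.
  have [->|A0] := eqVneq A set0.
    rewrite andbF big_set0 cards0 mulr0 subr0 mulr1.
    by case: ifP => // _; rewrite ler01.
  rewrite /= andbT; case: ifP => // _.
  by rewrite mulr0 subr0 mulr1.
(* Write [A] as the disjoint union of [Z] and a subset of [U :\: Z]: [Z] yields the factor 4^|Z| and
   lowers k by 2|Z|. *)
have e2 : \sum_(A : {set T} | (A \subset U) && (Z \subset A))
    (\prod_(u in A) r u) * (1 - 2 / k%:R * #|A|%:R) =
  4 ^+ #|Z| / k%:R * \sum_(A : {set T} | A \subset (U :\: Z)%SET)
    (\prod_(u in A) r u) * ((k%:Z - 2 * #|Z|%:Z)%:~R - 2 * #|A|%:R).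
  rewrite (reindex_onto (fun A => Z :|: A)%SET (fun A => A :\: Z)%SET) /=; last first.
    by move=> A /andP[_ /setIidPr ZA]; rewrite -{2}(setID A Z) ZA.
  rewrite mulr_sumr; apply: eq_big => [A|A].
    rewrite subsetUl andbT subUset ZU /= setDUl setDv set0U.
    rewrite subsetD; apply: andb_id2l => _.
    by rewrite (sameP eqP setDidPl).
  rewrite setDUl setDv set0U => /andP[_ /eqP/setDidPl dA].
  have dZ : [disjoint Z & A] by rewrite disjoint_sym.
  rewrite (eq_bigl [predU Z & A]) => [|u]; last by rewrite inE.
  rewrite bigU //= (eq_bigr _ rZ) prodr_const.
  rewrite cardsU disjoint_setI0 // cards0 subn0 natrD intrB intrM /=.
  by rewrite -!pmulrn; field.
have := sum_subsets_le (k%:Z - 2 * #|Z|%:Z) rB.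
move=> le3; rewrite !mulr1 mulr0 subr0 mul1r.
(* The right side is the exact negative of the term for [A = set0]. *)
have : 4 ^+ #|Z| / k%:R * 2 ^ (k%:Z - 2 * #|Z|%:Z - 1) = 4 * (2 ^ (k%:Z - 3) / k%:R) :> R.
  have -> : k%:Z - 2 * #|Z|%:Z - 1 = k%:Z - 3 + (2 - (2 * #|Z|)%N%:Z) by lia.
  move: (k%:Z - 3) => m; rewrite !expfzDr // -(exprnN 2 (2 * _)) -exprnP exprM.
  have -> : (2 : R) ^+ 2 = 4 by ring.
  by field; rewrite kR expf_neq0.
have : 4 ^+ #|Z| / k%:R * \sum_(A : {set T} | A \subset (U :\: Z)%SET)
    (\prod_(u in A) r u) * ((k%:Z - 2 * #|Z|%:Z)%:~R - 2 * #|A|%:R) <=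
    4 ^+ #|Z| / k%:R * 2 ^ (k%:Z - 2 * #|Z|%:Z - 1).
  by rewrite ler_wpM2l // divr_ge0 // exprn_ge0.
move: le1; rewrite e2; lra.
Qed.
(** * Local occupancy of maximal independent sets in girth 7 *)

Section LocalOccupancy.
Variables (G : sgraph) (S : {set G}) (v : G).
Hypothesis no_short_cycle : forall s : seq G, is_cycle s -> (6 < size s)%N.
Hypothesis vS : v \in S.

Implicit Types (A I J : {set G}) (x y z u w : G).

(** * Consequences of the girth inside the ball of radius 2 *)

Lemma edge_neq x y : edge x y -> x != y.
Proof. by apply: contraTneq => ->; rewrite edge_irr. Qed.

Lemma no_triangle x y z : edge x y -> edge y z -> ~~ edge x z.
Proof.
move=> xy yz; apply/negP => xz.
suff /no_short_cycle : is_cycle [:: x; y; z] by [].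
by rewrite /is_cycle /ucycleb /= !inE xy yz (edge_sym z) xz negb_or !edge_neq.
Qed.

Lemma no_4cycle x y z t : edge x y -> edge y z -> edge z t -> edge t x ->
  y != t -> x = z.
Proof.
move=> xy yz zt tx yt; apply/eqP; apply: contraT => xz.
suff /no_short_cycle : is_cycle [:: x; y; z; t] by [].
rewrite /is_cycle /ucycleb /= !inE xy yz zt tx !negb_or xz yt.
by rewrite (edge_neq xy) (edge_neq yz) (edge_neq zt) eq_sym (edge_neq tx).
Qed.

Definition nbrs : {set G} := [set u in S | edge v u].
Definition sphere2 : {set G} :=
  [set w in S | (w != v) && [exists u in nbrs, edge u w]].
Definition ball2 : {set G} := v |: nbrs :|: sphere2.

Lemma nbrsP u : reflect (u \in S /\ edge v u) (u \in nbrs).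
Proof. by rewrite inE; exact: andP. Qed.

Lemma sphere2P w : reflect [/\ w \in S, w != v &
  exists2 u, u \in nbrs & edge u w] (w \in sphere2).
Proof.
rewrite inE; apply: (iffP and3P) => [[wS wv /exists_inP h]|[wS wv h]]; split=> //.
exact/exists_inP.
Qed.

Lemma nbrs_sphere2 u : u \in nbrs -> u \notin sphere2.
Proof.
move=> /nbrsP[_ vu]; apply/sphere2P => -[_ _ [t /nbrsP[_ vt] tu]].
by move: (no_triangle vt tu); rewrite vu.
Qed.

Lemma nbrs_neq u : u \in nbrs -> u != v.
Proof. by move=> /nbrsP[_ /edge_neq]; rewrite eq_sym. Qed.

Lemma sphere2_neq w : w \in sphere2 -> w != v.
Proof. by move=> /sphere2P[]. Qed.

Lemma parent_uniq u t w : u \in nbrs -> t \in nbrs -> w != v ->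
  edge u w -> edge t w -> u = t.
Proof.
move=> /nbrsP[_ vu] /nbrsP[_ vt] wv uw tw; apply/eqP.
apply: contraNT wv => ut; apply/eqP; apply: (no_4cycle (y := u) (t := t)) => //.
all: by rewrite edge_sym.
Qed.

(** An edge inside the sphere would close a triangle with a common parent, or a 5-cycle through [v]
    with two distinct parents. *)
Lemma sphere2_independent : {in sphere2 &, forall w x, ~~ edge w x}.
Proof.
move=> w x /[dup] w2 /sphere2P[_ wv [u uN uw]] /[dup] x2 /sphere2P[_ xv [t tN tx]].
apply/negP => wx; have [ut|ut] := eqVneq u t.
  by subst t; move: (no_triangle uw wx); rewrite tx.
suff /no_short_cycle : is_cycle [:: v; u; w; x; t] by [].
have /nbrsP[_ vu] := uN; have /nbrsP[_ vt] := tN.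
have neq y z : y \in nbrs -> z \in sphere2 -> y != z.
  by move=> /nbrs_sphere2 yn zs; apply: contraNneq yn => ->.
rewrite /is_cycle /ucycleb /= !inE vu uw wx (edge_sym x) tx (edge_sym t) vt.
rewrite !negb_or !(eq_sym v) wv xv (nbrs_neq uN) (nbrs_neq tN) ut (edge_neq wx).
by rewrite (neq u w) // (neq u x) // !(eq_sym _ t) (neq t w) // (neq t x).
Qed.

(* The only use of the absence of 6-cycles. *)
Lemma sphere2_common w x z : w \in sphere2 -> x \in sphere2 -> z \notin ball2 ->
  edge z w -> edge z x -> w = x.
Proof.
move=> /[dup] w2 /sphere2P[wS wv [u uN uw]] /[dup] x2 /sphere2P[xS xv [t tN tx]].
rewrite !inE !negb_or => /andP[/andP[zv zN] z2] zw zx; apply/eqP.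
apply: contraT => wx; have /nbrsP[uS vu] := uN; have /nbrsP[tS vt] := tN.
have [ut|ut] := eqVneq u t.
  subst t; suff zu : z = u by rewrite zu uS vu in zN.
  by apply: (no_4cycle (y := w) (t := x)) => //; rewrite edge_sym.
suff /no_short_cycle : is_cycle [:: v; u; w; z; x; t] by [].
have neq y s : y \in nbrs -> s \in sphere2 -> y != s.
  by move=> /nbrs_sphere2 yn zs; apply: contraNneq yn => ->.
have zn y : y \in nbrs -> y != z.
  by move=> yN; apply: contraNneq zN => <-; rewrite inE in yN.
rewrite /is_cycle /ucycleb /= !inE vu uw zx (edge_sym w) zw (edge_sym x) tx.
rewrite (edge_sym t) vt !negb_or !(eq_sym v) wv xv zv (nbrs_neq uN) (nbrs_neq tN) ut wx.
rewrite (neq u w) // (neq u x) // !(eq_sym _ t) (neq t w) // (neq t x) //.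
by rewrite (zn u) // (zn t) // (edge_neq zx) (eq_sym w) (edge_neq zw).
Qed.

(** * Reconstruction from the traces outside the ball and on the neighbours *)

Definition free_sphere J : {set G} :=
  [set w in sphere2 | [forall y in J, ~~ edge w y]].

(* The only candidate for a maximal independent set with trace [J] outside the
   ball and [A] on the neighbours of [v]. *)
Definition config J A : {set G} :=
  [set x | [|| x \in J, x \in A, (A == set0) && (x == v) |
    (x \in free_sphere J) && [forall u in A, ~~ edge u x]]].

Lemma configP J A x :
  reflect [\/ x \in J, x \in A, A = set0 /\ x = v |
    x \in free_sphere J /\ {in A, forall u, ~~ edge u x}] (x \in config J A).
Proof.
rewrite [X in reflect _ X]in_set; apply: (iffP or4P).
  case=> [->|->|/andP[/eqP-> /eqP->]|/andP[xF /forall_inP nA]];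
    by [constructor 1|constructor 2|constructor 3|constructor 4].
case=> [->|->|[-> ->]|[xF /forall_inP nA]];
  [constructor 1|constructor 2|constructor 3|constructor 4] => //.
  by rewrite !eqxx.
by rewrite xF.
Qed.

Lemma free_sphereP J w : reflect (w \in sphere2 /\ {in J, forall y, ~~ edge w y})
  (w \in free_sphere J).
Proof.
by rewrite [X in reflect _ X]in_set; apply: (iffP andP) => -[w2 /forall_inP].
Qed.

Lemma config_nbrs J A : [disjoint J & ball2] -> A \subset nbrs ->
  config J A :&: nbrs = A.
Proof.
move=> JB /subsetP AN; apply/setP => x; rewrite in_setI; apply/andP/idP.
  case=> /configP[xJ|//|[_ ->]|[/free_sphereP[x2 _] _]] xN.
  - by have := disjointFr JB xJ; rewrite 2!in_setU xN orbT.
  - by move: (nbrs_neq xN); rewrite eqxx.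
  - by move: (nbrs_sphere2 xN); rewrite x2.
by move=> xA; split; [apply/configP; constructor 2|exact: AN].
Qed.

Lemma config_ball2 J A : [disjoint J & ball2] -> A \subset nbrs ->
  config J A :\: ball2 = J.
Proof.
move=> JB /subsetP AN; apply/setP => x; rewrite in_setD; apply/andP/idP.
  case=> xB /configP[//|/AN xA|[_ xv]|[/free_sphereP[x2 _] _]]; case/negP: xB.
  - by rewrite 2!in_setU xA orbT.
  - by rewrite 2!in_setU xv set11.
  - by rewrite 2!in_setU x2 !orbT.
by move=> xJ; rewrite (disjointFr JB xJ); split=> //; apply/configP; constructor 1.
Qed.

(** An excluded vertex must have a neighbour in [I]. For [v] it lies in [nbrs]; for a sphere vertex
    it lies in [nbrs] or outside the ball, as the sphere is independent. So the two traces leave no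
    choice. *)
Lemma maximal_independent_config I : maximal_independent S I ->
  config (I :\: ball2) (I :&: nbrs) = I.
Proof.
move=> /maximal_independentP[IS iI dI]; apply/setP => x; apply/configP/idP.
  case=> [|||[/free_sphereP[/[dup] x2 /sphere2P[xS xv [u uN ux]] xJ] xA]].
  - by rewrite in_setD => /andP[].
  - by rewrite in_setI => /andP[].
  - move=> [A0 ->]; apply: contraT => /(dI _ vS)[y yI vy].
    have yN : y \in nbrs by apply/nbrsP; split=> //; exact: IS.
    by have := in_set0 y; rewrite -A0 in_setI yI yN.
  apply: contraT => /(dI _ xS)[y yI xy].
  have [yB|yB] := boolP (y \in ball2); last first.
    by move: (xJ y); rewrite in_setD yB yI xy => /(_ isT).
  move: yB; rewrite 2!in_setU => /orP[/orP[/set1P yv|yN]|y2].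
  - by move: x2 => /negPn/negP[]; apply: nbrs_sphere2; rewrite inE xS -yv edge_sym.
  - by move: (xA y); rewrite in_setI yI yN edge_sym xy => /(_ isT).
  - by move: (sphere2_independent x2 y2); rewrite xy.
move=> xI; have [xB|xB] := boolP (x \in ball2); last first.
  by constructor 1; rewrite in_setD xB.
move: xB; rewrite 2!in_setU => /orP[/orP[/set1P xv|xN]|x2].
- constructor 3; split=> //; apply/eqP; apply: contraT => /set0Pn[y].
  rewrite in_setI => /andP[yI /nbrsP[_ vy]].
  by move: (iI x y xI yI); rewrite xv vy.
- by constructor 2; rewrite in_setI xI.
constructor 4; split.
  by apply/free_sphereP; split=> // y; rewrite in_setD => /andP[_ yI]; exact: iI.
by move=> u; rewrite in_setI => /andP[uI _]; exact: iI.
Qed.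

(** * Children and the size of a configuration *)

Definition children J u : {set G} := [set w in free_sphere J | edge u w].

Lemma in_children J u w :
  (w \in children J u) = (w \in free_sphere J) && edge u w.
Proof. by rewrite [LHS]in_set. Qed.

(** Each free sphere vertex has exactly one parent, by [parent_uniq], and is counted iff that parent
    is outside [A]. *)
Lemma free_sphere_card J A : A \subset nbrs ->
  #|[set w in free_sphere J | [forall u in A, ~~ edge u w]]| =
  (\sum_(u in nbrs :\: A) #|children J u|)%N.
Proof.
move=> AN; rewrite -sum1_card.
under [RHS]eq_bigr => u _ do rewrite -sum1_card.
rewrite (exchange_big_dep (fun w => w \in free_sphere J)) /=; last first.
  by move=> u w _; rewrite in_children => /andP[].
rewrite (eq_bigl (fun w => (w \in free_sphere J) && [forall u in A, ~~ edge u w]));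
  last by move=> w; rewrite [LHS]in_set.
rewrite big_mkcondr; apply: eq_bigr => w wF.
have /free_sphereP[/sphere2P[wS wv [u uN uw]] _] := wF.
have uE t : t \in nbrs -> edge t w -> t = u.
  by move=> tN tw; apply: (@parent_uniq t u w).
have [uA|uA] := boolP (u \in A).
  rewrite big_pred0 => [|t].
    by rewrite ifF //; apply/negP => /forall_inP/(_ u uA); rewrite uw.
  rewrite in_setD in_children wF /=; apply/negP => /andP[/andP[tA tN] tw].
  by move: tA; rewrite (uE t) // uA.
rewrite (big_pred1 u) => [|t].
  rewrite ifT //; apply/forall_inP => t tA; apply: contraNN uA => tw.
  by rewrite -(uE t) // (subsetP AN).
rewrite in_setD in_children wF /=; apply/idP/eqP => [/andP[/andP[_ tN] tw]|->].
  exact: uE.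
by rewrite uA uN.
Qed.

Lemma ball2N x : x \notin ball2 -> [/\ x != v, x \notin nbrs & x \notin sphere2].
Proof. by rewrite 2!in_setU in_set1 !negb_or => /andP[/andP[]]. Qed.

Lemma outside_nadj u x : x \in S -> x \notin ball2 -> u \in v |: nbrs ->
  ~~ edge u x.
Proof.
move=> xS /ball2N[xv xN x2]; rewrite in_setU => /orP[/set1P->|uN].
  by apply: contra xN => vx; apply/nbrsP.
by apply: contra x2 => ux; apply/sphere2P; split=> //; exists u.
Qed.

(** This makes 4^|[config J A]| a product over [A]: putting [u] into [A] gains one vertex and loses
    the children of [u]. *)
Lemma config_card J A : [disjoint J & ball2] -> A \subset nbrs ->
  #|config J A| =
  (#|J| + #|A| + (A == set0) + \sum_(u in nbrs :\: A) #|children J u|)%N.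
Proof.
move=> JB AN; rewrite -free_sphere_card //.
have Jout x : x \in J -> x \notin ball2 by move=> xJ; rewrite (disjointFr JB xJ).
set F := [set w in _ | _]; pose V := if A == set0 then [set v] else set0.
have FS x : x \in F -> x \in sphere2.
  by rewrite [x \in F]in_set => /andP[/free_sphereP[]].
have VE x : x \in V -> x = v.
  by rewrite /V; case: ifP => _; [move=> /set1P|rewrite in_set0].
have -> : config J A = J :|: A :|: V :|: F.
  apply/setP => x; rewrite [LHS]in_set 3!in_setU [x \in F]in_set -!orbA.
  by rewrite /V; case: ifP => _; rewrite ?in_set1 ?in_set0.
have cU (X Y : {set G}) : (forall x, x \in X -> x \in Y -> False) ->
    #|X :|: Y| = (#|X| + #|Y|)%N.
  move=> XY; rewrite cardsU; suff -> : X :&: Y = set0 by rewrite cards0 subn0.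
  by apply/setP => x; rewrite in_setI in_set0; apply/negP => /andP[/XY].
have -> : (A == set0 : nat) = #|V|.
  by rewrite /V; case: ifP => _; rewrite ?cards1 ?cards0.
rewrite !cU // => x.
- by move=> /Jout/ball2N[_ xN _] /(subsetP AN); rewrite (negPf xN).
- rewrite in_setU => + /VE xv; rewrite {x}xv => /orP[/Jout/ball2N[]|/(subsetP AN)/nbrs_neq];
    by rewrite eqxx.
rewrite 2!in_setU => + /FS x2; case/orP => [/orP[/Jout/ball2N[]|/(subsetP AN)/nbrs_sphere2]|/VE xv].
- by rewrite x2.
- by rewrite x2.
- by move: (sphere2_neq x2); rewrite xv eqxx.
Qed.

(* A vertex outside the ball can be dominated through at most one neighbour of
   [v], by [sphere2_common]; that neighbour must then stay out of the
   independent set. *)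
Definition blocked J : {set G} :=
  [set u in nbrs | [exists z in S :\: ball2 :\: J,
    [forall y in J, ~~ edge z y] &&
    [exists w in free_sphere J, edge z w && edge u w]]].

Lemma blockedP J u : reflect (u \in nbrs /\ exists z w,
   [/\ z \in S, z \notin ball2, z \notin J, {in J, forall y, ~~ edge z y} &
       [/\ w \in free_sphere J, edge z w & edge u w]]) (u \in blocked J).
Proof.
rewrite [X in reflect _ X]in_set; apply: (iffP andP) => -[uN].
  case/exists_inP => z; rewrite 2!in_setD => /and3P[zJ zB zS].
  move=> /andP[/forall_inP nz /exists_inP[w wF /andP[zw uw]]].
  by split=> //; exists z, w.
case=> z [w [zS zB zJ nz [wF zw uw]]]; split=> //; apply/exists_inP; exists z.
  by rewrite 2!in_setD zJ zB.
apply/andP; split; first exact/forall_inP.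
by apply/exists_inP; exists w => //; rewrite zw.
Qed.

(** Outside [A], such a vertex can be dominated only by [v], hence it is forced into every nonempty
    [A]. This is the [Z] of [config_sum_le]. *)
Definition childless J : {set G} := [set u in nbrs | children J u == set0].

Lemma childlessP J u : reflect (u \in nbrs /\ {in free_sphere J, forall w, ~~ edge u w})
  (u \in childless J).
Proof.
rewrite [X in reflect _ X]in_set; apply: (iffP andP) => -[uN].
  move=> /eqP c0; split=> // w wF; apply/negP => uw.
  by have := in_set0 w; rewrite -c0 in_children wF uw.
move=> nu; split=> //; apply/eqP/setP => w; rewrite in_children in_set0.
by apply/negP => /andP[/nu/negPf->].
Qed.

Lemma childless_blocked J : childless J \subset nbrs :\: blocked J.
Proof.
apply/subsetP => u /childlessP[uN nu]; rewrite in_setD uN andbT.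
apply/negP => /blockedP[_ [z [w [_ _ _ _ [wF _ uw]]]]].
by move: (nu w wF); rewrite uw.
Qed.

(** Only domination can fail: outside the ball, when [A] expels the one sphere vertex that could
    dominate there ([blocked]), and at a childless neighbour of [v] left out of a nonempty [A]. *)
Lemma maximal_independent_configE I A (J := I :\: ball2) :
  maximal_independent S I -> A \subset nbrs ->
  maximal_independent S (config J A) =
  (A \subset nbrs :\: blocked J) && ((A == set0) || (childless J \subset A)).
Proof.
move=> /maximal_independentP[IS iI dI] /subsetP AN.
have JP x : x \in J -> x \in I /\ x \notin ball2.
  by rewrite in_setD => /andP[].
apply/maximal_independentP/andP => [[CS iC dC]|[/subsetP AD AZ]]; split.
- apply/subsetP => u uA; rewrite in_setD AN // andbT.
  apply/negP => /blockedP[uN [z [w [zS zB zJ nz [wF zw uw]]]]].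
  have [zv zN z2] := ball2N zB.
  have [|y yC zy] := dC z zS.
    by apply/configP => -[|/AN||[/free_sphereP[]]] //; [apply/negP|apply/negP|
      case=> _ zv'; rewrite zv' eqxx in zv|rewrite (negPf z2)].
  case/configP: yC => [/nz|/AN yN|[_ yv]|[/free_sphereP[y2 _] nA]].
  + by rewrite zy.
  + by move: (outside_nadj zS zB (setU1r v yN)); rewrite edge_sym zy.
  + by move: (outside_nadj zS zB (setU11 v nbrs)); rewrite -yv edge_sym zy.
  + have /free_sphereP[w2 _] := wF.
    by move: (nA u uA); rewrite (sphere2_common y2 w2 zB zy zw) uw.
- have [//|A0] := eqVneq A set0; apply/subsetP => u /childlessP[uN nu].
  have /nbrsP[uS vu] := uN; apply: contraT => uA.
  have [|y yC uy] := dC u uS.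
    apply/configP => -[/JP[_ /ball2N[_ /negP]]||[_ uv]|[/free_sphereP[u2 _] _]] //.
    + exact/negP.
    + by move: (nbrs_neq uN); rewrite uv eqxx.
    + by move: (nbrs_sphere2 uN); rewrite u2.
  case/configP: yC => [/JP[yI yB]|/AN/nbrsP[_ vy]|[A0' _]|[yF _]].
  + by move: (outside_nadj (IS y yI) yB (setU1r v uN)); rewrite uy.
  + by move: (no_triangle vu uy); rewrite vy.
  + by move: A0; rewrite A0' eqxx.
  + by move: (nu y yF); rewrite uy.
- move=> x /configP[/JP[xI _]|/AN/nbrsP[]|[_ ->]|[/free_sphereP[/sphere2P[]]]] //.
  exact: IS.
- have JN x y : x \in J -> y \in v |: nbrs -> ~~ edge y x.
    by move=> /JP[xI xB]; apply: outside_nadj => //; exact: IS.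
  have vF x : x \in free_sphere J -> ~~ edge v x.
    move=> /free_sphereP[/[dup] x2 /sphere2P[xS _ _] _]; apply: contraL x2 => vx.
    by apply: nbrs_sphere2; apply/nbrsP.
  move=> x y /configP cx /configP cy.
  case: cx => [xJ|xA|[A0 ->]|[/[dup] xF /free_sphereP[x2 nxJ] nxA]];
    case: cy => [yJ|yA|[A0' ->]|[/[dup] yF /free_sphereP[y2 nyJ] nyA]].
  + by have [[xI _] [yI _]] := (JP x xJ, JP y yJ); exact: iI.
  + by rewrite edge_sym JN // setU1r // AN.
  + by rewrite edge_sym JN // setU11.
  + by rewrite edge_sym nyJ.
  + by rewrite JN // setU1r // AN.
  + have [/nbrsP[_ vx] /nbrsP[_ vy]] := (AN x xA, AN y yA).
    by apply: (@no_triangle x v y); rewrite // edge_sym.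
  + by move: xA; rewrite A0' in_set0.
  + exact: nyA.
  + by rewrite JN // setU11.
  + by move: yA; rewrite A0 in_set0.
  + by rewrite edge_irr.
  + exact: vF.
  + exact: nxJ.
  + by rewrite edge_sym nxA.
  + by rewrite edge_sym vF.
  + exact: sphere2_independent.
move=> x xS xC.
have [[y yJ xy]|nx] := pselect (exists2 y, y \in J & edge x y).
  by exists y => //; apply/configP; constructor 1.
have nxJ : {in J, forall y, ~~ edge x y}.
  by move=> y yJ; apply/negP => xy; apply: nx; exists y.
have [xv|xv] := eqVneq x v.
  have /set0Pn[u uA] : A != set0.
    by apply: contraNneq xC => A0; apply/configP; constructor 3.
  exists u; first by apply/configP; constructor 2.
  by rewrite xv; have /nbrsP[] := AN u uA.
have [xN|xN] := boolP (x \in nbrs).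
  case/orP: AZ => [/eqP A0|/subsetP AZ].
    exists v; first by apply/configP; constructor 3.
    by rewrite edge_sym; have /nbrsP[] := xN.
  have xA : x \notin A by apply: contra xC => xA; apply/configP; constructor 2.
  have [w wF xw] : exists2 w, w \in free_sphere J & edge x w.
    apply/exists_inP; apply: contraNT xA => /exists_inPn nw.
    by apply: AZ; apply/childlessP.
  exists w => //; apply/configP; constructor 4; split=> // u uA.
  apply: contraNN xA => uw; have /free_sphereP[/sphere2_neq wv _] := wF.
  by rewrite (parent_uniq xN (AN u uA) wv xw uw).
have [x2|x2] := boolP (x \in sphere2).
  have [u uA ux] : exists2 u, u \in A & edge u x.
    apply/exists_inP; apply: contraNT xC => /exists_inPn nu.
    by apply/configP; constructor 4; split=> //; apply/free_sphereP.
  by exists u; [apply/configP; constructor 2|rewrite edge_sym].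
have xB : x \notin ball2 by rewrite 2!in_setU in_set1 !negb_or xv xN.
have xJ : x \notin J by apply: contra xC => xJ; apply/configP; constructor 1.
(* The neighbour [y] of [x] in [I] must lie on the sphere. Were it expelled by some [u] in [A], the
   pair [x], [y] would show that [u] is blocked. *)
have [|y yI xy] := dI x xS; first by apply: contra xJ; rewrite in_setD xB.
have yJ : y \notin J by apply: contraL xy => /nxJ.
have yB : y \in ball2 by move: yJ; rewrite in_setD yI andbT negbK.
move: yB; rewrite in_setU => /orP[yN|y2].
  by move: (outside_nadj xS xB yN); rewrite edge_sym xy.
have yF : y \in free_sphere J.
  by apply/free_sphereP; split=> // z /JP[zI _]; exact: iI.
exists y => //; apply/configP; constructor 4; split=> // u uA.
apply/negP => uy; move: (AD u uA); rewrite in_setD => /andP[/negP + _]; apply.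
by apply/blockedP; split; [exact: AN|exists x, y].
Qed.

(** * The inequality for each trace [J] and its summation *)

Variable R : realType.

Lemma local_occupancy (k : nat) : (0 < k)%N ->
  \sum_(I | maximal_independent S I) 4 ^+ #|I| *
    (1 - (1 + 2 ^ (k%:Z - 3) / k%:R) * (v \in I)%:R
       - 2 / k%:R * #|I :&: nbrs|%:R) <= 0 :> R.
Proof.
move=> k0; rewrite (partition_big (fun I => I :\: ball2) predT) //=.
apply: sumr_le0 => J _.
(* [maximal_independent_configE] applies to traces of actual maximal independent sets; for any other
   [J] the sum is empty. *)
have [[I0 /andP[mI0 /eqP IJ]]|nI] :=
    pselect (exists I0, maximal_independent S I0 && (I0 :\: ball2 == J)); last first.
  by rewrite big_pred0 // => I; apply/negP => mI; apply: nI; exists I.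
have JB : [disjoint J & ball2].
  rewrite -setI_eq0; apply/eqP/setP => x; rewrite -IJ in_setI in_setD in_set0.
  by case: (x \in ball2); rewrite ?andbF.
(* By [config_card], 4^|[config J A]| is [K] times the product of [r] over [A], times 4 if [A] is
   empty. *)
pose r u : R := 4 / 4 ^+ #|children J u|.
pose K : R := 4 ^+ #|J| * 4 ^+ (\sum_(u in nbrs) #|children J u|)%N.
have := @config_sum_le R G r (nbrs :\: blocked J) (childless J) k k0
  (childless_blocked J).
set X := \sum_(A | _) _ => le0.
suff -> : \sum_(I | maximal_independent S I && (I :\: ball2 == J)) 4 ^+ #|I| *
    (1 - (1 + 2 ^ (k%:Z - 3) / k%:R) * (v \in I)%:R
       - 2 / k%:R * #|I :&: nbrs|%:R) = K * X.
  rewrite mulr_ge0_le0 // ?mulr_ge0 ?exprn_ge0 //; apply: le0 => u.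
    by rewrite [_ \in _]in_set => /andP[_ /eqP c0]; rewrite /r c0 cards0 divr1.
  rewrite 2!in_setD => /and3P[uZ _ uN]; rewrite /r.
  have c0 : (0 < #|children J u|)%N.
    by rewrite card_gt0; apply: contra uZ; rewrite [_ \in childless J]in_set uN.
  rewrite divr_ge0 ?exprn_ge0 //= ler_pdivrMr ?exprn_gt0 // mul1r.
  by rewrite -[leLHS]expr1 ler_eXn2l // ltr1n.
rewrite (reindex_onto (config J) (fun I => I :&: nbrs)) /=; last first.
  by move=> I /andP[mI /eqP <-]; exact: maximal_independent_config.
rewrite mulr_sumr; apply: eq_big => [A|A].
  have [AN|AN] := boolP (A \subset nbrs); last first.
    have -> : (config J A :&: nbrs == A) = false.
      by apply: contraNF AN => /eqP <-; exact: subsetIr.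
    have -> : (A \subset nbrs :\: blocked J) = false.
      by apply: contraNF AN => /subset_trans; apply; exact: subsetDl.
    by rewrite andbF.
  rewrite config_ball2 // config_nbrs // !eqxx !andbT -IJ.
  exact: maximal_independent_configE.
move=> /andP[/andP[_ _] /eqP eA].
have AN : A \subset nbrs by rewrite -eA subsetIr.
have vC : (v \in config J A) = (A == set0).
  apply/configP/eqP => [[vJ|/(subsetP AN)/nbrs_neq|[]|[/free_sphereP[/sphere2_neq]]]|A0] //.
  - by move: (disjointFr JB vJ); rewrite 2!in_setU set11.
  - by rewrite eqxx.
  - by rewrite eqxx.
  - by constructor 3.
rewrite config_nbrs // vC [RHS]mulrA; congr (_ * _).
rewrite config_card // /r /K [(\sum_(u in nbrs) _)%N](big_setID A) /= (setIidPr AN) !exprD.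
rewrite prodf_div prodr_const -expr_sum.
have p0 m : (4 : R) ^+ m != 0 by rewrite expf_neq0 // pnatr_eq0.
by case: ifP => _ /=; rewrite ?expr1 ?expr0; field; rewrite !p0.
Qed.

End LocalOccupancy.

(** * Greedy fractional colouring *)

Definition marginal (R : realType) (G : sgraph) (p : {set G} -> R) (v : G) : R :=
  \sum_(I : {set G} | v \in I) p I.

Lemma marginal_ge0 (R : realType) (G : sgraph) (p : {set G} -> R) (v : G) :
  (forall I, 0 <= p I) -> 0 <= marginal p v.
Proof. by move=> p0; apply: sumr_ge0. Qed.

(* Induction on the set [S] of vertices with nonzero demand: follow [p S] for the
   longest time [t] that exceeds no demand. If [X] meets [S], the local
   hypothesis shows that the quantities bounded by [M] drop by at least [t]. *)
Lemma greedy_fractional_colouring (R : realType) (G : sgraph) (a b : G -> R)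
    (p : {set G} -> {set G} -> R) :
  (forall v, 0 <= a v) -> (forall v, 0 <= b v) ->
  (forall S I, 0 <= p S I) ->
  (forall S, \sum_I p S I = 1) ->
  (forall S I, p S I != 0 -> (I \subset S) && independent I) ->
  (forall S, S != set0 -> p S set0 = 0) ->
  (forall (S : {set G}) v, v \in S -> 1 <= a v * marginal (p S) v +
     b v * \sum_(u | edge v u) marginal (p S) u) ->
  forall w : G -> R, (forall v, 0 <= w v) ->
  exists c : {set G} -> R,
    [/\ forall I, 0 <= c I,
        forall I, c I != 0 -> (I != set0) && independent I,
        forall v, marginal c v = w v &
        forall (X : {set G}) (M : R), 0 <= M ->
          (forall v, v \in X -> a v * w v + b v * \sum_(u | edge v u) w u <= M) ->
          \sum_(I | I :&: X != set0) c I <= M].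
Proof.
move=> a0 b0 p0 p1 pI pS0 ploc w; pose supp (w : G -> R) : {set G} := [set v | w v != 0]%SET.
have [n] := ubnP #|supp w|; elim: n => // n IH in w * => wn w0.
set S := supp w.
have [S0|[v vS]] := set_0Vmem S.
  exists (fun=> 0); split=> //.
  - by move=> I; rewrite eqxx.
  - move=> v; rewrite /marginal big1 //; apply/esym/eqP.
    by apply: contraFT (in_set0 v) => wv; rewrite -S0 inE.
  - by move=> X M M0 _; rewrite big1.
have Sn0 : S != set0 by apply/set0Pn; exists v.
set P := marginal (p S).
have P0 u : 0 <= P u by apply: marginal_ge0 => I; exact: p0.
have PS u : u \notin S -> P u = 0.
  move=> uS; apply: big1 => I uI; apply: contraNeq uS => /pI /andP[/subsetP IS _].
  exact: IS.
(* If all marginals vanished, the local inequality at [v] would read 1 <= 0. *)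
have [x xP] : exists x, P x != 0.
  apply/existsP; apply: contraPT (ploc S v vS) => /existsPn nP; apply/negP; rewrite -ltNge.
  rewrite -/P (eqP (negPn (nP v))) mulr0 add0r big1 ?mulr0 ?ltr01 // => u _.
  exact/eqP/negPn.
(* The least ratio is the time at which a first demand is exhausted; [y] then leaves the support. *)
case: (@arg_minP _ R G x (fun u => P u != 0) (fun u => w u / P u) xP)
  => y yP ymin.
set t := w y / P y.
have t0 : 0 <= t by rewrite divr_ge0.
have tP u : t * P u <= w u.
  have [->|uP] := eqVneq (P u) 0; first by rewrite mulr0.
  by rewrite -ler_pdivlMr ?lt0r ?uP ?P0 //; exact: ymin.
have yS : y \in S by apply: contraR yP => /PS ->.
pose w' u := w u - t * P u.
have w'0 u : 0 <= w' u by rewrite subr_ge0.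
have ssS : supp w' \proper S.
  apply/properP; split.
    apply/subsetP => u; rewrite !inE; apply: contra => /eqP wu.
    rewrite /w' wu sub0r oppr_eq0; have := tP u; rewrite wu => tP0.
    by rewrite eq_le tP0 mulr_ge0.
  by exists y => //; rewrite inE /w' /t divfK ?subrr ?eqxx.
have [c [c0 cI cw cX]] := IH w' (leq_trans (proper_card ssS) wn) w'0.
exists (fun I => t * p S I + c I); split.
- by move=> I; apply: addr_ge0 => //; apply: mulr_ge0.
- move=> I; have [->|cI0 _] := eqVneq (c I) 0; last exact: cI.
  rewrite addr0 mulf_eq0 negb_or => /andP[_ pI0]; have /andP[_ ->] := pI _ _ pI0.
  by rewrite andbT; apply: contraNneq pI0 => ->; rewrite pS0.
- move=> u; rewrite /marginal big_split /= -mulr_sumr -/(marginal c u) cw.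
  by rewrite -/(marginal (p S) u) -/P addrC subrK.
move=> X M M0 XM.
have wE u : w u = t * P u + w' u by rewrite addrC subrK.
have wsum u : a u * w u + b u * \sum_(z | edge u z) w z =
    t * (a u * P u + b u * \sum_(z | edge u z) P z) +
    (a u * w' u + b u * \sum_(z | edge u z) w' z).
  have -> : \sum_(z | edge u z) w z =
      t * \sum_(z | edge u z) P z + \sum_(z | edge u z) w' z.
    by rewrite mulr_sumr -big_split; apply: eq_bigr => z _; exact: wE.
  by rewrite {1}wE; ring.
have tX u : u \in X :&: S ->
    t + (a u * w' u + b u * \sum_(z | edge u z) w' z) <= M.
  rewrite inE => /andP[uX uS]; apply: le_trans (XM u uX); rewrite wsum lerD2r.
  by rewrite ler_peMr //; exact: ploc.
(* The marginals of [c] are [w'], whose support lies in [S]. *)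
have sup I u : c I != 0 -> u \in I -> u \in S.
  move=> cI0 uI; apply: (subsetP (proper_sub ssS)); rewrite inE -cw.
  rewrite /marginal (bigD1 I) //= paddr_eq0 ?c0 ?sumr_ge0 //.
  by rewrite negb_and cI0.
have [XS0|[u uXS]] := set_0Vmem (X :&: S).
  rewrite big1 // => I IX0; have /set0Pn[u] := IX0; rewrite inE => /andP[uI uX].
  have uS : u \notin S by apply: contraFN (in_set0 u); rewrite -XS0 in_setI uX.
  have /eqP-> : c I == 0 by apply: contraNT uS => /sup; apply.
  have /eqP-> : p S I == 0.
    by apply: contraNT uS => /pI /andP[/subsetP IS _]; exact: IS.
  by rewrite mulr0 addr0.
have Mt : 0 <= M - t.
  have := tX u uXS; rewrite addrC -lerBrDr; apply: le_trans.
  by rewrite addr_ge0 ?mulr_ge0 ?sumr_ge0.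
(* The bound [M - t] is available only on [S], hence [X :&: S]; sets of nonzero weight in [c] lie in
   [S], so they meet [X] iff they meet [X :&: S]. *)
have cXM := cX (X :&: S) _ Mt; rewrite big_split /= -mulr_sumr.
rewrite -(subrKC t M) lerD //.
  rewrite -[leRHS]mulr1 ler_wpM2l // -(p1 S) [leLHS]big_mkcond; apply: ler_sum => I _.
  by case: ifP.
apply: le_trans (cXM _) => [|z zXS]; last by rewrite lerBrDl; exact: tX.
rewrite big_mkcond [leRHS]big_mkcond; apply: ler_sum => I _.
have [->|cI0] := eqVneq (c I) 0; first by rewrite !if_same.
case: ifP => [/set0Pn[z]|_]; last by case: ifP.
rewrite inE => /andP[zI zX]; rewrite ifT //; apply/set0Pn; exists z.
by rewrite !in_setI zI zX; exact: sup zI.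
Qed.

(** * The weighted distribution on maximal independent sets *)

Lemma sum_card_edge (G : sgraph) (S I : {set G}) (v : G) : I \subset S ->
  #|I :&: nbrs S v| = (\sum_(u | edge v u) (u \in I))%N.
Proof.
move=> /subsetP IS; rewrite -sum1_card big_mkcond [RHS]big_mkcond.
apply: eq_bigr => u _; rewrite in_setI [_ \in nbrs _ _]in_set.
by have [/IS->|_] := boolP (u \in I); case: (edge v u).
Qed.

(** The [k] attaining the minimum at [y] is a candidate at [x]. *)
Lemma f_bound_le (R : realType) (x y : R) : 0 <= x -> x <= y ->
  f_bound x <= f_bound y.
Proof.
move=> x0 xy; have [k k0 ->] := f_bound_attained (le_trans x0 xy).
rewrite lerD2l; apply: (@le_trans _ _ ((2 * x + 2 ^ (k%:Z - 3)) / k%:R)).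
  apply: ge_inf; last by exists k.
  exists 0 => _ [j _ <-]; rewrite divr_ge0 // addr_ge0 ?mulr_ge0 //.
by rewrite ler_wpM2r ?invr_ge0 // lerD2r ler_wpM2l.
Qed.

Lemma f_bound_ge0 (R : realType) (x : R) : 0 <= x -> 0 <= f_bound x.
Proof.
move=> x0; have [k k0 ->] := f_bound_attained x0.
by rewrite addr_ge0 // divr_ge0 // addr_ge0 ?mulr_ge0 // exprz_ge0.
Qed.

(** Each [I] contributes only to its own trace [h I], which is nonempty only if [I] meets [S]. *)
Lemma restriction_weight_le (R : realType) (G : sgraph) (c : {set G} -> R)
    (S : {set G}) : (forall I, 0 <= c I) ->
  restriction_weight c S <= \sum_(I | I :&: S != set0) c I.
Proof.
move=> c0; pose h (I : {set G}) : {set Defs.induced S} := [set x | val x \in I].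
have hE (I : {set G}) (J : {set Defs.induced S}) : (I :&: S == val @: J) -> h I = J.
  move=> /eqP IJ; apply/setP => x; rewrite in_set.
  by rewrite -(mem_imset _ _ val_inj) -IJ in_setI (valP x) andbT.
rewrite (bigID (fun I => independent (h I) && (h I != set0))) /=.
rewrite (partition_big h (fun J => independent J && (J != set0))) /=; last first.
  by move=> I /andP[].
apply: ler_wpDr; first exact: sumr_ge0.
apply: ler_sum => J /andP[iJ J0].
rewrite /restriction big_mkcond [leRHS]big_mkcond; apply: ler_sum => I _.
case: ifP => [IJ|_]; last by case: ifP.
rewrite (hE I J IJ) eqxx iJ J0 !andbT ifT //.
have [x xJ] := set0Pn _ J0; apply/set0Pn; exists (val x).
by rewrite (eqP IJ) imset_f.
Qed.

Section Distribution.
Variables (R : realType) (G : sgraph).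

(** The hard-core model at fugacity 4, restricted to maximal independent sets. *)
Definition hardcore_weight (S I : {set G}) : R :=
  if maximal_independent S I then 4 ^+ #|I| else 0.

Definition hardcore (S I : {set G}) : R :=
  hardcore_weight S I / \sum_J hardcore_weight S J.

Lemma hardcore_weight_ge0 S I : 0 <= hardcore_weight S I.
Proof. by rewrite /hardcore_weight; case: ifP => // _; rewrite exprn_ge0. Qed.

Lemma hardcore_total_gt0 S : 0 < \sum_J hardcore_weight S J.
Proof.
have [I mI] := maximal_independent_exists S; rewrite (bigD1 I) //=.
rewrite ltr_wpDr ?sumr_ge0 // => [J _|]; first exact: hardcore_weight_ge0.
by rewrite /hardcore_weight mI exprn_gt0.
Qed.

Lemma hardcore_ge0 S I : 0 <= hardcore S I.
Proof. by rewrite divr_ge0 ?hardcore_weight_ge0 // ltW // hardcore_total_gt0. Qed.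

Lemma hardcore_sum1 S : \sum_I hardcore S I = 1.
Proof. by rewrite -mulr_suml divff // gt_eqF // hardcore_total_gt0. Qed.

Lemma hardcore_neq0 S I : hardcore S I != 0 -> maximal_independent S I.
Proof.
by apply: contraR => nI; rewrite /hardcore /hardcore_weight (negPf nI) mul0r.
Qed.

(** This is [local_occupancy] divided by the total weight, with the expected size of
    [I :&: nbrs S v] written as a sum of marginals by linearity. *)
Lemma hardcore_occupancy (S : {set G}) (v : G) (k : nat) :
  (forall s : seq G, is_cycle s -> (6 < size s)%N) -> v \in S -> (0 < k)%N ->
  1 <= (1 + 2 ^ (k%:Z - 3) / k%:R) * marginal (hardcore S) v +
    2 / k%:R * \sum_(u | edge v u) marginal (hardcore S) u.
Proof.
move=> cG vS k0; set a := 1 + _; set b := 2 / _; set p := hardcore S.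
have mE u : marginal p u = \sum_I p I * (u \in I)%:R.
  by rewrite /marginal big_mkcond; apply: eq_bigr => I _; rewrite mulr_natr mulrb.
have -> : \sum_(u | edge v u) marginal p u = \sum_I p I * #|I :&: nbrs S v|%:R.
  under eq_bigr => u _ do rewrite mE.
  rewrite exchange_big; apply: eq_bigr => I _; rewrite -mulr_sumr -natr_sum.
  have [->|/hardcore_neq0/and3P[IS _ _]] := eqVneq (p I) 0; first by rewrite !mul0r.
  by rewrite sum_card_edge.
have : \sum_I p I * (1 - a * (v \in I)%:R - b * #|I :&: nbrs S v|%:R) <= 0.
  under eq_bigr => I _ do rewrite /p /hardcore mulrAC.
  rewrite -mulr_suml mulr_le0_ge0 // ?invr_ge0 ?(ltW (hardcore_total_gt0 S)) //.
  apply: le_trans (local_occupancy cG vS R k0); rewrite [leRHS]big_mkcond.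
  apply: ler_sum => I _; rewrite /hardcore_weight.
  by case: ifP => _; rewrite ?mul0r.
have -> : \sum_I p I * (1 - a * (v \in I)%:R - b * #|I :&: nbrs S v|%:R) =
    1 - a * marginal p v - b * \sum_I p I * #|I :&: nbrs S v|%:R.
  rewrite -[X in _ = X - _ - _](hardcore_sum1 S) mE !mulr_sumr -!sumrB.
  by apply: eq_bigr => I _; rewrite /p; ring.
lra.
Qed.

End Distribution.

Theorem theorem1p11 (R : realType) (G : sgraph) :
  (7%:E <= girth R G)%E ->
  (exists c : {set G} -> R,
     fractional_colouring c /\
     forall S : {set G},
       restriction_weight c S <= f_bound ((\max_(v in S) deg v)%N%:R : R)) /\
  chi_f R G <= f_bound ((max_deg G)%:R : R).
Proof.
move=> g7; have cG (s : seq G) : is_cycle s -> (6 < size s)%N := girth_cycle g7.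
have /choice[k kP] (v : G) : exists k : nat, (0 < k)%N /\
    f_bound ((deg v)%:R : R) = 1 + (2 * (deg v)%:R + 2 ^ (k%:Z - 3)) / k%:R.
  by have [j] := f_bound_attained (ler0n R (deg v)); exists j.
have k0 v : (0 < k v)%N by case: (kP v).
(* With these coefficients and all demands 1, the quantity to bound at [v] is 1 + 2^(k-3)/k + (2/k)
   deg v, which equals [f_bound] at deg v by the choice of [k v]. *)
have [||||||||c [c0 cI cw cX]] := @greedy_fractional_colouring R G
  (fun v => 1 + 2 ^ ((k v)%:Z - 3) / (k v)%:R) (fun v => 2 / (k v)%:R)
  (@hardcore R G) _ _ _ _ _ _ _ (fun=> 1).
- by move=> v; rewrite addr_ge0 // divr_ge0 // exprz_ge0.
- by move=> v; rewrite divr_ge0.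
- exact: hardcore_ge0.
- exact: hardcore_sum1.
- by move=> S I /hardcore_neq0/and3P[-> ->].
- move=> S /set0Pn[v vS]; apply: contraTeq vS => /hardcore_neq0.
  move=> /maximal_independentP[_ _ dS]; apply/negP => vS.
  by have [|y] := dS v vS; rewrite in_set0.
- by move=> S v vS; exact: hardcore_occupancy.
- by [].
have fc : fractional_colouring c.
  split=> // [I nI|v]; last by rewrite -/(marginal c v) cw.
  by apply: contraNeq nI => /cI /andP[].
have cS (S : {set G}) : \sum_(I | I :&: S != set0) c I <=
    f_bound ((\max_(v in S) deg v)%N%:R : R).
  apply: cX; first exact: f_bound_ge0.
  move=> v vS; rewrite mulr1 sumr_const.
  apply: (@le_trans _ _ (f_bound ((deg v)%:R : R))).
    have [_ ->] := kP v.
    by rewrite -/(deg v); lra.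
  by apply: f_bound_le => //; rewrite ler_nat; exact: leq_bigmax_cond.
split.
  by exists c; split=> // S; apply: le_trans (cS S); exact: restriction_weight_le.
apply: (@le_trans _ _ (weight c)).
  apply: ge_inf; last by exists c.
  by exists 0 => _ [d [d0 _ _] <-]; exact: sumr_ge0.
(* [weight] also counts the empty set, to which [c] gives weight 0 by [cI]. *)
have := cS setT; rewrite /max_deg (eq_bigl predT) => [|v]; last by rewrite in_setT.
apply: le_trans; rewrite /weight big_mkcond [leRHS]big_mkcond; apply: ler_sum => I _.
rewrite setIT; case: eqVneq => // ->; have [->//|/cI] := eqVneq (c set0) 0.
by rewrite eqxx.
Qed.
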